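(* Let $n\ge1$ and let $\mu\subset\lambda$ be partitions with at most $n$ parts (stable dominant weights, of type $A_{2n-1}$). Then the map $$\bigcup_{\eta\ \mathrm{even}}\mathrm{LR}(\lambda/\mu,\eta)\ \longrightarrow\ \mathcal{LR}(\lambda,\mu),\qquad T\mapsto v(T),$$ is a bijection between $\bigcup_{\eta\ \mathrm{even}}\mathrm{LR}(\lambda/\mu,\eta)$ (which in this case is the set of Littlewood-Richardson-Sundaram tableaux of skew shape $\lambda/\mu$) and the set of lattice points of the convex polytope $\mathcal{LR}(\lambda,\mu)\subset\mathbb{R}^{n(n+1)/2}$.
   Context: Partitions are identified with Young diagrams; a partition is of type $A_{2n-1}$ if it has at most $2n-1$ rows, stable if it has at most $n$ rows, and even if every column of its diagram has an even number of boxes. A skew tableau of skew shape $\lambda/\mu$ is a filling of the boxes of $\lambda$ not in $\mu$ with entries in $\{1<\dots<2n\}$, strictly increasing down columns and weakly increasing along rows. Its word is read column by column from right to left, each column from top to bottom. $\mathrm{LR}(\lambda/\mu,\eta)$ is the set of Littlewood-Richardson tableaux of skew shape $\lambda/\mu$ and weight $\eta$: skew tableaux in whose word every prefix contains at least as many $i$'s as $(i+1)$'s for all $i$, and which contain exactly $\eta_i$ entries $i$ for each $i$. Here $\eta$ is a partition of type $A_{2n-1}$. A Littlewood-Richardson tableau is (n-symplectic) Sundaram if $\eta$ is even, $\mu$ is stable, and $2i+1$ does not appear strictly below row $n+i$ for $i\in\{0,\dots,\frac12 l(\eta)\}$, where $l(\eta)$ is the number of rows of $\eta$; this last condition holds automatically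 when $\lambda$ is stable. For a skew tableau $T$ of shape $\lambda/\mu$, $v(T)$ is the vector of the numbers $(i,j):=$ number of $i$'s in row $j$ of $T$, for $1\le i\le j\le n$. (For $T$ in $\bigcup_{\eta\ \mathrm{even}}\mathrm{LR}(\lambda/\mu,\eta)$ there are no entries $i$ in row $j$ with $i>j$.) $\mathcal{LR}(\lambda,\mu)$ is the set of real vectors $((i,j))_{1\le i\le j\le n}$ with $(i,j)\ge 0$, satisfying the shape conditions $\sum_{i=1}^{j}(i,j)=\lambda_j-\mu_j$ for $1\le j\le n$ and, with the conventions $(0,j):=\mu_j$ for $1\le j\le n$ and $(i,j):=0$ whenever $i>j$, $i>n$ or $j>n$: $$\sum_{p=0}^{i-1}(p,j)\ \ge\ \sum_{p=0}^{i}(p,j+1)\qquad(1\le i\le j\le n),$$ $$\sum_{q=i}^{j}(i,q)\ \ge\ \sum_{q=i+1}^{j+1}(i+1,q)\qquad(1\le i\le j\le n),$$ $$\sum_{q=1}^{n}(j,q)\ =\ \sum_{q=1}^{n}(j+1,q)\qquad(1\le j\le n,\ j\text{ odd}).$$ *)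

(* Defs.v *)
From HB Require Import structures.
From mathcomp Require Import all_boot all_order all_algebra.
From mathcomp Require Import boolp classical_sets functions reals.

Set Implicit Arguments.
Unset Strict Implicit.
Unset Printing Implicit Defensive.

Import Order.TTheory GRing.Theory Num.Theory.
Local Open Scope classical_set_scope.
Local Open Scope ring_scope.

(* A partition is the weakly decreasing list of its nonzero parts, so that its
   number of rows is its size.  Rows, columns and entries are all numbered
   from 1. *)
Definition is_partition (s : seq nat) : bool := sorted geq s && (0%N \notin s).

Definition part (s : seq nat) (j : nat) : nat := nth 0%N s j.-1.

Definition typeA (n : nat) (s : seq nat) : bool :=
  is_partition s && (size s <= n.*2.-1)%N.

Definition stable (n : nat) (s : seq nat) : bool :=
  is_partition s && (size s <= n)%N.

Definition subpart (mu lam : seq nat) : Prop :=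
  forall j : nat, (1 <= j)%N -> (part mu j <= part lam j)%N.

Definition col_len (s : seq nat) (c : nat) : nat :=
  count (fun r : nat => (c <= r)%N) s.

Definition even_part (s : seq nat) : Prop :=
  forall c : nat, (1 <= c)%N -> ~~ odd (col_len s c).

Definition in_skew (lam mu : seq nat) (r c : nat) : bool :=
  [&& (1 <= r)%N, (part mu r < c)%N & (c <= part lam r)%N].

Definition box (lam mu : seq nat) : finType :=
  {b : 'I_(size lam).+1 * 'I_(part lam 1).+1 | in_skew lam mu b.1 b.2}.

Definition brow (lam mu : seq nat) (b : box lam mu) : nat := (val b).1.
Definition bcol (lam mu : seq nat) (b : box lam mu) : nat := (val b).2.

Definition filling (lam mu : seq nat) : Type := {ffun box lam mu -> nat}.

Definition skew_tableau (n : nat) (lam mu : seq nat) (T : filling lam mu) : Prop :=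
  [/\ forall b : box lam mu, (1 <= T b <= n.*2)%N,
      forall b b' : box lam mu,
        bcol b = bcol b' -> (brow b < brow b')%N -> (T b < T b')%N
    & forall b b' : box lam mu,
        brow b = brow b' -> (bcol b < bcol b')%N -> (T b <= T b')%N].

(* In the comprehension the first (outer) index is the column. *)
Definition reading (lam mu : seq nat) : seq (box lam mu) :=
  pmap (fun b => insub b : option (box lam mu))
    [seq (r, c) | c <- rev (enum 'I_(part lam 1).+1), r <- enum 'I_(size lam).+1].

Definition word (lam mu : seq nat) (T : filling lam mu) : seq nat :=
  [seq T b | b <- reading lam mu].

Definition lattice_word (w : seq nat) : Prop :=
  forall u : seq nat, prefix u w ->
  forall i : nat, (1 <= i)%N -> (count_mem i.+1 u <= count_mem i u)%N.

Definition LR (n : nat) (lam mu eta : seq nat) : set (filling lam mu) :=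
  [set T | [/\ skew_tableau n T,
               lattice_word (word T)
             & forall i : nat, (1 <= i)%N ->
                 #|[set b | T b == i]%SET| = part eta i]].
Arguments LR : clear implicits.

Definition even_LR (n : nat) (lam mu : seq nat) : set (filling lam mu) :=
  \bigcup_(eta in [set eta | typeA n eta /\ even_part eta]) LR n lam mu eta.
Arguments even_LR : clear implicits.

Definition LR_Sundaram (n : nat) (lam mu : seq nat) : set (filling lam mu) :=
  [set T | exists eta : seq nat,
     [/\ typeA n eta, LR n lam mu eta T, even_part eta, stable n mu
       & forall i : nat, (i <= (size eta)./2)%N ->
         forall b : box lam mu, T b = i.*2.+1 -> (brow b <= n + i)%N]].
Arguments LR_Sundaram : clear implicits.

(* The pairs (i, j) with 1 <= i <= j <= n; there are n(n+1)/2 of them. *)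
Definition tri (n : nat) : finType :=
  {p : 'I_n.+1 * 'I_n.+1 | (1 <= p.1 <= p.2)%N}.

Definition vec (R : Type) (n : nat) : Type := {ffun tri n -> R}.

Definition v (R : realType) (n : nat) (lam mu : seq nat) (T : filling lam mu) :
    vec R n :=
  [ffun p : tri n =>
     #|[set b | (brow b == (val p).2) && (T b == (val p).1)]%SET|%:R].
Arguments v R n {lam mu} T.

(* The coordinate (i, j) of x, extended by (0, j) = mu_j for 1 <= j <= n.
   For i >= 1 the sum has a single term when 1 <= i <= j <= n, and is empty
   (hence 0) otherwise. *)
Definition coord (R : realType) (n : nat) (mu : seq nat) (x : vec R n)
    (i j : nat) : R :=
  if i == 0%N then (if (1 <= j <= n)%N then (part mu j)%:R else 0)
  else \sum_(p : tri n | ((val p).1 == i :> nat) && ((val p).2 == j :> nat)) x p.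

Definition LR_polytope (R : realType) (n : nat) (lam mu : seq nat) :
    set (vec R n) :=
  [set x |
    let a := coord mu x in
    [/\ forall p : tri n, 0 <= x p,
        forall j : nat, (1 <= j <= n)%N ->
          \sum_(1 <= i < j.+1) a i j = (part lam j)%:R - (part mu j)%:R,
        forall i j : nat, (1 <= i)%N -> (i <= j)%N -> (j <= n)%N ->
          \sum_(0 <= p < i) a p j >= \sum_(0 <= p < i.+1) a p j.+1,
        forall i j : nat, (1 <= i)%N -> (i <= j)%N -> (j <= n)%N ->
          \sum_(i <= q < j.+1) a i q >= \sum_(i.+1 <= q < j.+2) a i.+1 q
      & forall j : nat, (1 <= j <= n)%N -> odd j ->
          \sum_(1 <= q < n.+1) a j q = \sum_(1 <= q < n.+1) a j.+1 q]].
Arguments LR_polytope : clear implicits.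

(* A bounded intersection of finitely many closed half-spaces. *)
Definition convex_polytope (R : realType) (n : nat) (P : set (vec R n)) : Prop :=
  (exists hs : seq (vec R n * R),
     P = [set x : vec R n |
       forall h, h \in hs -> \sum_(p : tri n) h.1 p * x p <= h.2]) /\
  (exists M : R, forall x : vec R n, P x -> forall p : tri n, `|x p| <= M).

Definition lattice_points (R : realType) (n : nat) : set (vec R n) :=
  [set x | forall p : tri n, exists z : int, x p = z%:~R].
Arguments lattice_points : clear implicits.

(* Main.v *)
Require Import Defs.
From HB Require Import structures.
From mathcomp Require Import all_boot all_order all_algebra.
From mathcomp Require Import boolp classical_sets functions reals.
From mathcomp Require Import zify.

Set Implicit Arguments.
Unset Strict Implicit.
Unset Printing Implicit Defensive.

Import Order.TTheory GRing.Theory Num.Theory.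

(** Write (i,j) for the number of i's in row j, with (0,j) = mu_j, and
    row_end j i = (0,j) + ... + (i,j).  Rows increase weakly, so the boxes of
    row j with entries at most i are the leftmost ones, and they reach up to
    the column row_end j i:
      T(j,c) <= i   iff   c <= row_end j i.
    This equivalence (tableau_row_end) recovers T from the numbers (i,j),
    whence injectivity.  In the other direction an array of numbers defines T
    by it (array_filling), and the inequalities between row_end j (i-1) and
    row_end (j+1) i say that the columns of T increase strictly.

    What remains is to read off the lattice property from the numbers (i,j).
    The word goes through the columns, whereas the second family of
    inequalities of the polytope counts by rows: it says that the first j+1
    rows contain at most as many i+1's as the first j rows contain i's.
    For a skew tableau the two conditions agree (lattice_upper and
    upper_lattice), because entries increase weakly towards the south-east:
    - the prefix of the word that ends at the leftmost i+1 of row j+1 contains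
      every i+1 of the rows up to j+1, and no i below row j;
    - conversely, if j+1 is the lowest row in which a prefix has an i+1, then
      every i in the first j rows that the prefix omits has directly below it
      an i+1, omitted as well.  Subtracting what is omitted from the counts by
      rows leaves the inequality for the prefix.
    Applied repeatedly, the row condition also shows that i cannot occur in row
    j when i > j, since an i in row j would require an entry in row 0
    (upper_diagonal).  Hence the coordinates 1 <= i <= j <= n carry all the numbers and the weight
    of T has at most n parts.  The row bound in the definition of a Sundaram
    tableau holds because lam has at most n rows.

    Finally the weight eta is even iff eta_j = eta_(j+1) for all odd j
    (even_partP), which is the last condition on the polytope.  All conditions
    are affine in the coordinates and finite in number, so that they cut out a
    polyhedron; nonnegativity and the row sums bound it. *)

(** * Partitions and their column lengths *)

Lemma geq_trans : transitive geq.
Proof. by move=> y x z /= xy yz; exact: leq_trans xy. Qed.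

Lemma part_geq s i j : is_partition s -> i <= j -> part s j <= part s i.
Proof.
case/andP=> s_sorted _ le_ij; rewrite /part.
have [js|js] := ltnP j.-1 (size s); last by rewrite (nth_default _ js).
apply: (sorted_leq_nth geq_trans leqnn 0 s_sorted); rewrite ?inE //; lia.
Qed.

Lemma part_default s j : size s < j -> part s j = 0.
Proof. by case: j => // j lt_sj; rewrite /part nth_default. Qed.

(** Column lengths and parts are conjugate: both sides say that the box in
    row i+1 and column c belongs to the diagram. *)
Lemma leq_part_col_len s c i :
  sorted geq s -> 0 < c -> (c <= part s i.+1) = (i < col_len s c).
Proof.
rewrite /part /col_len /= => + c0; elim: s i => [|x s IHs] i /=.
  by rewrite nth_nil leqNgt c0.
move=> xs; have s_sorted := path_sorted xs.
have [cx|xc] := leqP c x; first by case: i => [|i] /=; rewrite ?cx // IHs.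
have /allP x_max := order_path_min geq_trans xs.
rewrite (@eq_in_count _ _ pred0) ?count_pred0; last first.
  by move=> y /x_max /= yx; apply/negbTE; rewrite -ltnNge (leq_ltn_trans yx).
rewrite ltn0; apply/negbTE; rewrite -ltnNge; case: i => [|i] //=.
have [ilt|ige] := ltnP i (size s); last by rewrite nth_default.
by apply: leq_ltn_trans xc; exact/x_max/mem_nth.
Qed.

(** A column of odd length j ends in row j, so it exists iff rows j and j+1
    differ in length. *)
Lemma even_partP s : is_partition s ->
  (forall j, odd j -> part s j = part s j.+1) <-> even_part s.
Proof.
move=> s_part; have s_sorted : sorted geq s by case/andP: s_part.
split=> [eq_s c c0|s_even j j_odd].
  apply/negP=> len_odd; set l := col_len s c in len_odd.
  have l0 : l = l.-1.+1 by case: (l) len_odd.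
  have : c <= part s l by rewrite l0 leq_part_col_len // -/l; lia.
  by rewrite eq_s // leq_part_col_len // ltnn.
apply/eqP; rewrite eqn_leq (part_geq s_part (leqnSn j)) andbT.
have [->//|c0] := posnP (part s j).
have j0 : j = j.-1.+1 by case: (j) j_odd.
rewrite leq_part_col_len // ltn_neqAle.
have -> : j <= col_len s (part s j).
  by rewrite {1}j0 -leq_part_col_len // -j0.
rewrite andbT; apply: contraTneq j_odd => ->; exact: s_even.
Qed.

(** The zeros of a decreasing sequence come last and nth returns 0 beyond the
    end, so dropping them turns a weight vector into a partition without
    changing its parts. *)
Lemma nth_filter_pos s i :
  sorted geq s -> nth 0 [seq x <- s | 0 < x] i = nth 0 s i.
Proof.
elim: s i => [|x s IHs] i //= xs.
case: ltnP => [x0|]; first by case: i => [|i] //=; rewrite IHs // (path_sorted xs).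
rewrite leqn0 => /eqP x0.
have := order_path_min geq_trans xs; rewrite x0 => /allP s0.
rewrite (@eq_in_filter _ _ pred0) ?filter_pred0; last first.
  by move=> y /s0 /=; rewrite leqn0 => /eqP ->.
rewrite nth_nil; case: i => [|i] //=.
have [ilt|ige] := ltnP i (size s); last by rewrite nth_default.
by have := s0 _ (mem_nth 0 ilt); rewrite /= leqn0 => /eqP ->.
Qed.

(** * Lexicographic products, filtered counts and partial sums *)

Lemma pairwise_allpairs (A : eqType) (B : eqType) (rA : rel A) (rB : rel B)
    (s : seq A) (t : seq B) : pairwise rA s -> pairwise rB t ->
  pairwise (fun p q => rA p.2 q.2 || ((p.2 == q.2) && rB p.1 q.1))
    [seq (y, x) | x <- s, y <- t].
Proof.
move=> + t_pw; elim: s => //= a s IHs /andP[/allP a_min s_pw].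
rewrite pairwise_cat IHs // andbT pairwise_map; apply/andP; split.
  apply/allrelP => p q /mapP[b bt ->] /allpairsP[[a' b'] [a's _ ->]] /=.
  by rewrite (a_min _ a's).
by apply: sub_pairwise t_pw => b b' /= ->; rewrite eqxx orbT.
Qed.

Lemma count_uniq (A : finType) (p : pred A) (s : seq A) :
  uniq s -> count p s = #|[set x | (x \in s) && p x]%SET|.
Proof.
move=> s_uniq; rewrite -size_filter -(card_uniqP _) ?filter_uniq //.
by apply: eq_card => x; rewrite inE mem_filter andbC.
Qed.

(** The least i that satisfies a monotone predicate forms a Galois connection
    with it. *)
Lemma find_iota_leq (P : pred nat) n i :
  (forall j k, j <= k -> P j -> P k) -> P n ->
  (find P (iota 0 n.+1) <= i) = P i.
Proof.
move=> P_up Pn; have P_has : has P (iota 0 n.+1).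
  by apply/hasP; exists n; rewrite // mem_iota add0n ltnSn.
have f_lt : find P (iota 0 n.+1) < n.+1 by rewrite -[X in _ < X](size_iota 0) -has_find.
apply/idP/idP => [|Pi]; last rewrite leqNgt.
  by move/P_up; apply; have := nth_find 0 P_has; rewrite nth_iota.
apply/negP => i_lt; have := before_find 0 i_lt.
by rewrite nth_iota ?add0n ?Pi // (ltn_trans i_lt).
Qed.

Lemma leq_psum (f : nat -> nat) i k :
  i <= k -> \sum_(0 <= p < i) f p <= \sum_(0 <= p < k) f p.
Proof. by move=> ik; rewrite (big_cat_nat _ ik) //= leq_addr. Qed.

Lemma psum_const (f : nat -> nat) i k :
  i <= k -> (forall p, i <= p -> f p = 0) ->
  \sum_(0 <= p < k) f p = \sum_(0 <= p < i) f p.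
Proof.
move=> ik f0; rewrite (big_cat_nat _ ik) //= -[RHS]addn0; congr (_ + _).
by rewrite big_nat big1 // => p /andP[ip _]; exact: f0.
Qed.

(** * Boxes of a skew diagram *)

Section Boxes.
Variables (lam mu : seq nat).
Hypotheses (lam_part : is_partition lam) (mu_part : is_partition mu).
Implicit Types b x y : box lam mu.

Lemma box_skew b : in_skew lam mu (brow b) (bcol b).
Proof. exact: (valP b). Qed.

Lemma brow_gt0 b : 0 < brow b.
Proof. by case/and3P: (box_skew b). Qed.

Lemma brow_le b : brow b <= size lam.
Proof. by rewrite -ltnS ltn_ord. Qed.

Lemma box_inj x y : brow x = brow y -> bcol x = bcol y -> x = y.
Proof.
move=> /val_inj eq_row /val_inj eq_col; apply: val_inj.
by rewrite [LHS]surjective_pairing [RHS]surjective_pairing eq_row eq_col.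
Qed.

Lemma box_exists r c :
  in_skew lam mu r c -> exists2 b : box lam mu, brow b = r & bcol b = c.
Proof.
move=> rc; have /and3P[r0 muc clam] := rc.
have rlt : r < (size lam).+1.
  rewrite ltnS leqNgt; apply/negP => lt_sr.
  by move: clam; rewrite (part_default lt_sr); lia.
have clt : c < (part lam 1).+1.
  by rewrite ltnS (leq_trans clam) // part_geq.
by exists (exist _ (Ordinal rlt, Ordinal clt) rc).
Qed.

(** Skew diagrams are convex: they contain with two boxes every box weakly
    south-east of the first and north-west of the second. *)
Lemma box_between x y r c : brow x <= r <= brow y -> bcol x <= c <= bcol y ->
  exists2 b : box lam mu, brow b = r & bcol b = c.
Proof.
move=> /andP[xr ry] /andP[xc cy]; apply: box_exists.
have /and3P[r0 mux _] := box_skew x; have /and3P[_ _ ylam] := box_skew y.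
rewrite /in_skew (leq_trans r0 xr) /=; apply/andP; split.
  by apply: leq_ltn_trans (leq_trans mux xc); exact: part_geq.
by apply: leq_trans cy (leq_trans ylam _); exact: part_geq.
Qed.

Lemma card_row_initial r c : 0 < r -> part mu r <= c <= part lam r ->
  #|[set b : box lam mu | (brow b == r) && (bcol b <= c)]%SET| = c - part mu r.
Proof.
move=> r0; elim: c => [|c IHc] /andP[muc clam].
  rewrite sub0n; apply/eqP; rewrite cards_eq0; apply/eqP/setP=> b; rewrite !inE.
  by case/and3P: (box_skew b) => _ lt_mu _; apply/negbTE; rewrite negb_and; lia.
move: muc; rewrite leq_eqVlt => /predU1P[eq_mu|muc].
  rewrite eq_mu subnn; apply/eqP; rewrite cards_eq0; apply/eqP/setP=> b.
  rewrite !inE; apply/negP => /andP[/eqP br bc].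
  by case/and3P: (box_skew b); rewrite br; lia.
have [|x xr xc] := @box_exists r c.+1; first by rewrite /in_skew r0 muc clam.
rewrite ltnS in muc; rewrite subSn // -IHc ?muc ?(ltnW clam) //.
rewrite (_ : finset _ = x |: [set b : box lam mu | (brow b == r) && (bcol b <= c)])%SET.
  by rewrite cardsU1 !inE xc ltnn andbF.
apply/setP=> b; rewrite !inE; apply/idP/idP.
  move=> /andP[/eqP br]; rewrite leq_eqVlt => /predU1P[bc|bc].
    by rewrite (box_inj (x:=b) (y:=x)) ?eqxx ?br ?xr ?bc ?xc.
  by rewrite br eqxx -ltnS bc orbT.
by case/orP=> [/eqP->|/andP[-> bc]]; rewrite ?xr ?xc ?eqxx ?leqnn //= ltnW.
Qed.

(** * The reading order *)

Definition before x y : bool :=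
  (bcol y < bcol x) || ((bcol x == bcol y) && (brow x < brow y)).

Lemma before_total x y : x != y -> before x y || before y x.
Proof.
move=> neq_xy; have : (brow x != brow y) || (bcol x != bcol y).
  rewrite -negb_and; apply: contra neq_xy => /andP[/eqP ? /eqP ?].
  exact/eqP/box_inj.
by rewrite /before; lia.
Qed.

Lemma before_trans : transitive before.
Proof. by move=> y x z; rewrite /before; lia. Qed.

Lemma before_asym x y : before x y -> ~~ before y x.
Proof. by rewrite /before; lia. Qed.

Lemma mem_reading b : b \in reading lam mu.
Proof.
rewrite mem_pmap_sub; apply/allpairsP; exists ((val b).2, (val b).1) => /=.
by rewrite mem_rev !mem_enum -surjective_pairing.
Qed.

Lemma reading_pairwise : pairwise before (reading lam mu).
Proof.
set s := enum 'I_(part lam 1).+1; set t := enum 'I_(size lam).+1.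
have s_pw : pairwise (fun c d : 'I_(part lam 1).+1 => d < c) (rev s).
  rewrite -(pairwise_map val (fun c d => d < c)) map_rev val_enum_ord.
  rewrite -sorted_pairwise; last by move=> c d e; lia.
  by rewrite rev_sorted iota_ltn_sorted.
have t_pw : pairwise (fun r q : 'I_(size lam).+1 => r < q) t.
  rewrite -(pairwise_map val ltn) val_enum_ord.
  by rewrite -(sorted_pairwise ltn_trans) iota_ltn_sorted.
have := pairwise_allpairs s_pw t_pw.
set r := (X in pairwise X _) => st_pw.
have : pairwise r (map val (reading lam mu)).
  by rewrite /reading pmap_filter ?pairwise_filter //; exact: insubK.
by rewrite pairwise_map.
Qed.

Lemma reading_uniq : uniq (reading lam mu).
Proof.
apply: pairwise_uniq reading_pairwise => b.
by apply/negP => bb; have := before_asym bb; rewrite bb.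
Qed.

Lemma filter_initial (D : {set box lam mu}) (s : seq (box lam mu)) :
  (forall x y, y \in D -> before x y -> x \in D) -> pairwise before s ->
  filter [in D] s = take (count [in D] s) s.
Proof.
move=> D_init; elim: s => [|x s IHs] //= /andP[/allP xs /IHs eq_s].
have [xD|xD] := boolP (x \in D); first by rewrite eq_s.
suff : ~~ has [in D] s.
  rewrite has_count -leqNgt leqn0 => /eqP s0.
  by rewrite add0n s0 take0; apply: size0nil; rewrite size_filter.
apply/hasPn => y ys; apply: contra xD => yD; exact: D_init (xs y ys).
Qed.

(** The prefixes of the reading are the initial sets of boxes for the reading
    order, so a lattice word can be tested on sets instead of sequences. *)
Lemma lattice_wordP (T : filling lam mu) :
  lattice_word (word T) <->
  forall D : {set box lam mu},
    (forall x y, y \in D -> before x y -> x \in D) ->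
  forall i, 0 < i ->
    #|[set b in D | T b == i.+1]%SET| <= #|[set b in D | T b == i]%SET|.
Proof.
split=> [T_lat D D_init i i0|T_lat u].
  have := T_lat (map T (filter [in D] (reading lam mu))) _ i i0.
  rewrite !count_map !count_filter !(count_uniq _ reading_uniq).
  have eqD k : [set b | (b \in reading lam mu) && predI (preim T (pred1 k)) [in D] b]%SET
      = [set b in D | T b == k]%SET.
    by apply/setP => b; rewrite !inE mem_reading /= andbC.
  rewrite !eqD; apply.
  (* Listed in reading order, D is a prefix of the reading. *)
  rewrite (filter_initial D_init reading_pairwise) map_take.
  exact: prefix_take.
rewrite prefixE => /eqP <- i i0; rewrite /word -map_take !count_map.
set k := size u.
have := reading_pairwise; have := reading_uniq; have := mem_reading.
move: (reading lam mu) => rd; rewrite -(cat_take_drop k rd) pairwise_cat cat_uniq.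
move=> cover /and3P[t_uniq _ _] /and3P[/allrelP t_before _ _].
rewrite cat_take_drop; set tk := take k rd in cover t_uniq t_before *.
rewrite !count_uniq //.
have eqD j : [set b | (b \in tk) && preim T (pred1 j) b]%SET =
    [set b in [set c | c \in tk] | T b == j]%SET.
  by apply/setP => b; rewrite !inE.
rewrite !eqD; apply: T_lat i0 => x y; rewrite !inE => y_tk xy.
have := cover x; rewrite mem_cat => /orP[//|x_dr].
by have := before_asym xy; rewrite t_before.
Qed.

(** * Lattice words counted by rows *)

Section Tableau.
Variables (n : nat) (T : filling lam mu).
Hypothesis T_skew : skew_tableau n T.

Lemma tableau_leq x y : brow x <= brow y -> bcol x <= bcol y -> T x <= T y.
Proof.
case: T_skew => _ T_col T_row xy_row xy_col.
have [||z zr zc] := @box_between x y (brow x) (bcol y).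
- by rewrite leqnn.
- by rewrite xy_col leqnn.
apply: (@leq_trans (T z)).
  move: xy_col; rewrite leq_eqVlt => /predU1P[xyc|xyc].
    by rewrite (box_inj (x:=x) (y:=z)) // zc.
  by apply: T_row; rewrite ?zc.
move: xy_row; rewrite leq_eqVlt => /predU1P[xyr|xyr].
  by rewrite (box_inj (x:=z) (y:=y)) // zr.
by apply/ltnW/T_col; rewrite ?zr.
Qed.

Lemma tableau_ltn x y : brow x < brow y -> bcol x <= bcol y -> T x < T y.
Proof.
case: T_skew => _ T_col _ xy_row xy_col.
have [||z zr zc] := @box_between x y (brow x) (bcol y).
- by rewrite leqnn ltnW.
- by rewrite xy_col leqnn.
apply: (@leq_ltn_trans (T z)); first by apply: tableau_leq; rewrite ?zr ?zc.
by apply: T_col; rewrite ?zr.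
Qed.

Definition upper i j : {set box lam mu} :=
  [set b | (brow b <= j) && (T b == i)]%SET.

(** If i+1 occurs in row j+1, the prefix of the word that ends at its leftmost
    occurrence there contains every i+1 of the rows up to j+1, and its i's lie
    in the rows up to j.  If it does not occur, row j+1 can be dropped. *)
Lemma lattice_upper i j : lattice_word (word T) -> 0 < i ->
  #|upper i.+1 j.+1| <= #|upper i j|.
Proof.
move=> /lattice_wordP T_lat i0.
have step k : (exists2 b, brow b = k.+1 & T b = i.+1) ->
    #|upper i.+1 k.+1| <= #|upper i k|.
  case=> b0 b0r b0T.
  have Pb0 : (brow b0 == k.+1) && (T b0 == i.+1) by rewrite b0r b0T !eqxx.
  have [x /andP[/eqP xr /eqP xT] x_min] :=
    @arg_minnP _ b0 (fun b => (brow b == k.+1) && (T b == i.+1)) (@bcol lam mu) Pb0.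
  pose D := [set b | (b == x) || before b x]%SET.
  have D_init y z : z \in D -> before y z -> y \in D.
    rewrite !inE => /predU1P[->|zx yz]; first by move->; rewrite orbT.
    by rewrite (before_trans yz zx) orbT.
  (* D is the prefix that ends at x. *)
  apply: leq_trans (leq_trans (T_lat D D_init i i0) _); apply: subset_leq_card.
    apply/fintype.subsetP => b; rewrite !inE => /andP[br /eqP bT]; rewrite bT eqxx andbT.
    have [//|bx /=] := eqVneq b x.
    have [//|xb] := orP (before_total bx).
    (* An i+1 read after x lies weakly west of it: in a higher row its entry is
       less than T x, and in the row of x it is x that is leftmost. *)
    have [br'|br'] := ltnP (brow b) k.+1.
      have : T b < T x by apply: tableau_ltn; move: xb; rewrite /before; lia.
      by rewrite bT xT ltnn.
    have := x_min b; rewrite eqn_leq br br' bT eqxx => /(_ isT).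
    by move: xb; rewrite /before; lia.
  apply/fintype.subsetP => b; rewrite !inE => /andP[bD /eqP bT]; rewrite bT eqxx andbT.
  rewrite leqNgt; apply/negP => br.
  suff : T x <= T b by rewrite xT bT ltnn.
  by case/predU1P: bD => [->//|bx]; apply: tableau_leq; move: bx; rewrite /before; lia.
elim: j => [|j IHj].
  have [b /andP[/eqP br /eqP bT]|none] :=
    pickP (fun b : box lam mu => (brow b == 1) && (T b == i.+1)).
    by apply: step; exists b.
  rewrite (_ : upper i.+1 1 = finset.set0) ?cards0 //; apply/setP=> b; rewrite !inE.
  by apply: contraFF (none b) => /andP[br ->]; rewrite eqn_leq br brow_gt0.
have [b /andP[/eqP br /eqP bT]|none] :=
  pickP (fun b : box lam mu => (brow b == j.+2) && (T b == i.+1)).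
  by apply: step; exists b.
apply: leq_trans (leq_trans IHj _); apply/subset_leq_card/fintype.subsetP => b; rewrite !inE.
  move=> /andP[br bT]; rewrite bT andbT -ltnS ltn_neqAle br andbT.
  by apply: contraFN (none b) => ->; rewrite bT.
by case/andP=> br ->; rewrite (leq_trans br).
Qed.

(** Take a prefix D and the lowest row j+1 in which D has an i+1.  Every i of
    the rows up to j that D omits lies directly above an i+1 that D omits, so
    in the inequality for the rows the omitted boxes can be cancelled. *)
Lemma upper_lattice :
  (forall i j, 0 < i -> #|upper i.+1 j.+1| <= #|upper i j|) ->
  lattice_word (word T).
Proof.
move=> T_up; apply/lattice_wordP => D D_init i i0.
have [b0 /andP[b0D /eqP b0T]|none] :=
  pickP (fun b : box lam mu => (b \in D) && (T b == i.+1)); last first.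
  rewrite (_ : [set b in D | _]%SET = finset.set0) ?cards0 //.
  by apply/setP => b; rewrite !inE none.
have Pb0 : (b0 \in D) && (T b0 == i.+1) by rewrite b0D b0T eqxx.
have [x /andP[xD /eqP xT] x_max] :=
  @arg_maxnP _ b0 (fun b => (b \in D) && (T b == i.+1)) (@brow lam mu) Pb0.
set j := (brow x).-1.
have xr : brow x = j.+1 by rewrite prednK // brow_gt0.
(* The box below b lies weakly north-west of x, so its entry is at most i+1; being
   larger than T b = i, it is i+1.  It is read after b, hence also omitted. *)
have below b : b \in upper i j :\: D ->
    exists2 c, c \in upper i.+1 j.+1 :\: D & brow c = (brow b).+1 /\ bcol c = bcol b.
  rewrite !inE => /and3P[bD br /eqP bT].
  have bx : b != x by apply: contraNneq bD => ->.
  have xb : before x b.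
    by case/orP: (before_total bx) => // bx'; case/negP: bD; exact: D_init xD bx'.
  have bc : bcol b <= bcol x by move: xb; rewrite /before; lia.
  have [||c cr cc] := @box_between b x (brow b).+1 (bcol b); rewrite ?leqnn ?leqnSn ?xr //.
  exists c => //; rewrite !inE cr ltnS br /=; apply/andP; split.
    apply: contra bD => cD; apply: D_init cD _.
    by rewrite /before cr cc eqxx ltnSn orbT.
  rewrite eqn_leq -xT tableau_leq ?cr ?cc ?xr //= xT -bT.
  by apply: tableau_ltn; rewrite ?cr ?cc.
pose f b := odflt b [pick c | (brow c == (brow b).+1) && (bcol c == bcol b)].
have fE b : b \in upper i j :\: D ->
    [/\ f b \in upper i.+1 j.+1 :\: D, brow (f b) = (brow b).+1 & bcol (f b) = bcol b].
  move/below => [c cU [cr cc]]; rewrite /f; case: pickP => [d|/(_ c)].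
    move=> /andP[/eqP dr /eqP dc] /=.
    by rewrite (box_inj (x:=d) (y:=c)) ?dr ?dc ?cr ?cc.
  by rewrite cr cc !eqxx.
have f_inj : {in upper i j :\: D &, injective f}.
  move=> b c /fE[_ br bc] /fE[_ cr cc] bcE; apply: box_inj.
    by apply: succn_inj; rewrite -br -cr bcE.
  by rewrite -bc -cc bcE.
have le_out : #|upper i j :\: D| <= #|upper i.+1 j.+1 :\: D|.
  rewrite -(card_in_imset f_inj); apply/subset_leq_card/fintype.subsetP => c.
  by case/imsetP => b /fE[fb _ _] ->.
have := T_up i j i0; rewrite -(cardsID D (upper i.+1 _)) -(cardsID D (upper i j)).
have -> : #|upper i.+1 j.+1 :&: D| = #|[set b in D | T b == i.+1]%SET|.
  apply: eq_card => b; rewrite !inE andbC; have [bD|//] := boolP (b \in D).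
  have [bT|_] := eqVneq (T b) i.+1; last by rewrite andbF.
  by have := x_max b; rewrite bD bT eqxx xr => /(_ isT) /= ->.
have : #|upper i j :&: D| <= #|[set b in D | T b == i]%SET|.
  apply/subset_leq_card/fintype.subsetP => b; rewrite !inE.
  by case/andP => /andP[_ ->] ->.
by move: le_out; lia.
Qed.

End Tableau.

End Boxes.

(** * Arrays of entry counts *)

(** When a i j is the number of i's in row j and a 0 j = mu_j, this is the last
    column of row j in which mu or an entry at most i is found. *)
Definition row_end (a : nat -> nat -> nat) (j i : nat) : nat :=
  \sum_(0 <= p < i.+1) a p j.

Lemma row_endS a j i : row_end a j i.+1 = row_end a j i + a i.+1 j.
Proof. by rewrite /row_end big_nat_recr. Qed.

Lemma row_end_mono a j i k : i <= k -> row_end a j i <= row_end a j k.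
Proof. by move=> ik; exact: leq_psum. Qed.

(** The conditions of the polytope on a natural array, freed from the bounds on
    the indices: this is the form that the counts in a tableau satisfy directly
    and that the construction of a tableau uses.  The row index 0 is allowed in
    the sums because it makes the induction over rows start from nothing. *)
Record lr_array (n : nat) (lam mu : seq nat) (a : nat -> nat -> nat) : Prop :=
  LRArray {
    array_mu : forall j, 0 < j -> a 0 j = part mu j;
    array_support : forall i j, 0 < i -> ~~ (i <= j <= n) -> a i j = 0;
    array_lam : forall j, 0 < j -> row_end a j j = part lam j;
    array_strict : forall i j, 0 < j -> row_end a j.+1 i.+1 <= row_end a j i;
    array_lattice : forall i j, 0 < i ->
      \sum_(0 <= q < j.+2) a i.+1 q <= \sum_(0 <= q < j.+1) a i q;
    array_even : forall j, odd j ->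
      \sum_(0 <= q < n.+1) a j q = \sum_(0 <= q < n.+1) a j.+1 q }.

Section Arrays.
Variables (n : nat) (lam mu : seq nat).
Hypotheses (lam_part : is_partition lam) (mu_part : is_partition mu).
Hypotheses (lam_rows : size lam <= n) (mu_sub_lam : subpart mu lam).
Implicit Types (T : filling lam mu) (b x y : box lam mu).

Lemma brow_stable b : brow b <= n.
Proof. exact: leq_trans (brow_le b) lam_rows. Qed.

Definition row_count T i j : nat :=
  #|[set b | (brow b == j) && (T b == i)]%SET|.

Definition entry_array T i j : nat :=
  if i == 0 then part mu j else row_count T i j.

Lemma card_upper T i j : #|upper T i j| = \sum_(0 <= q < j.+1) row_count T i q.
Proof.
elim: j => [|j IHj].
  by rewrite big_nat1; apply: eq_card => b; rewrite !inE leqn0.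
rewrite big_nat_recr //= -IHj -(cardsID [set b | brow b <= j]%SET (upper T i j.+1)).
congr (_ + _).
  apply: eq_card => b; rewrite !inE; case: (T b == i); rewrite ?andbF //=; lia.
by apply: eq_card => b; rewrite !inE; case: (T b == i); rewrite ?andbF //=; lia.
Qed.

Lemma card_weight T i : #|[set b | T b == i]%SET| = #|upper T i n|.
Proof. by apply: eq_card => b; rewrite !inE brow_stable. Qed.

(** An initial segment of a row is determined by its size. *)
Lemma row_initial r (A : {set box lam mu}) b :
  (forall x, x \in A -> brow x = r) ->
  (forall x y, y \in A -> brow x = r -> bcol x <= bcol y -> x \in A) ->
  brow b = r -> (b \in A) = (bcol b <= part mu r + #|A|).
Proof.
move=> A_row A_init br; have /and3P[r0 mub blam] := box_skew b; rewrite br in r0 mub blam.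
apply/idP/idP => [bA|].
  rewrite -leq_subLR -(card_row_initial lam_part mu_part r0) ?blam ?(ltnW mub) //.
  apply/subset_leq_card/fintype.subsetP => x; rewrite inE => /andP[/eqP xr].
  exact: A_init.
apply: contraLR => bA; rewrite -ltnNge -ltn_subRL.
have [c bc] : exists c, bcol b = c.+1 by case: (bcol b) mub => // c _; exists c.
have muc : part mu r <= c by rewrite -ltnS -bc.
rewrite bc subSn // ltnS -(card_row_initial lam_part mu_part r0); last by rewrite muc ltnW -?bc.
apply/subset_leq_card/fintype.subsetP => x xA; rewrite inE A_row // eqxx /=.
rewrite -ltnS -bc ltnNge; apply: contra bA; exact: A_init.
Qed.

Lemma row_end_entries T j i : (forall b, 0 < T b) ->
  row_end (entry_array T) j i =
    part mu j + #|[set b | (brow b == j) && (T b <= i)]%SET|.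
Proof.
move=> T_gt0; elim: i => [|i IHi].
  rewrite /row_end big_nat1 /entry_array /= -[LHS]addn0; congr (_ + _).
  apply/esym/eqP; rewrite cards_eq0; apply/eqP/setP => b.
  by rewrite !inE leqn0 eqn0Ngt T_gt0 andbF.
rewrite row_endS IHi -addnA; congr (_ + _).
rewrite -(cardsID [set b | T b <= i]%SET [set b | _ & T b <= i.+1]%SET).
congr (_ + _); apply: eq_card => b; rewrite !inE.
  by case: (brow b == j) => //=; lia.
by case: (brow b == j); rewrite ?andbF //=; lia.
Qed.

(** The Galois connection that encodes T by its array. *)
Lemma tableau_row_end T b i : skew_tableau n T ->
  (T b <= i) = (bcol b <= row_end (entry_array T) (brow b) i).
Proof.
move=> T_skew; have T_gt0 x : 0 < T x by case: T_skew => /(_ x)/andP[].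
rewrite row_end_entries // -row_initial ?inE ?eqxx // => [x|x y]; rewrite !inE.
  by case/andP=> /eqP.
move=> /andP[/eqP yr yi] xr xy; rewrite xr eqxx (leq_trans _ yi) //.
by apply: (tableau_leq lam_part mu_part T_skew); rewrite ?xr ?yr.
Qed.

Lemma card_row j : 0 < j ->
  part mu j + #|[set b : box lam mu | brow b == j]%SET| = part lam j.
Proof.
move=> j0; rewrite -[RHS](subnKC (mu_sub_lam j0)); congr (_ + _).
rewrite -(card_row_initial lam_part mu_part j0) ?mu_sub_lam ?leqnn //.
apply: eq_card => b; rewrite !inE.
by case: eqP => //= <-; case/and3P: (box_skew b) => _ _ ->.
Qed.

(** * From tableaux to arrays *)

(** Row by row, an i+1 in the first j+1 rows requires an i in the first j rows,
    and row 0 is empty. *)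
Lemma upper_diagonal T i j : skew_tableau n T -> lattice_word (word T) ->
  j < i -> #|upper T i j| = 0.
Proof.
move=> T_skew T_lat; elim: i j => // i IHi [|j] ji.
  apply/eqP; rewrite cards_eq0; apply/eqP/setP => b; rewrite !inE leqn0.
  by rewrite eqn0Ngt brow_gt0.
apply/eqP; rewrite -leqn0 -(IHi j) //.
by apply: (lattice_upper lam_part mu_part T_skew) => //; case: (i) ji.
Qed.

Lemma entry_leq_row T b : skew_tableau n T -> lattice_word (word T) -> T b <= brow b.
Proof.
move=> T_skew T_lat; rewrite leqNgt; apply/negP => /(upper_diagonal T_skew T_lat).
by move/eqP; rewrite cards_eq0 => /eqP/setP/(_ b); rewrite !inE leqnn eqxx.
Qed.

Lemma even_LR_array T : even_LR n lam mu T -> lr_array n lam mu (entry_array T).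
Proof.
case=> eta [/andP[eta_part _] eta_even] [T_skew T_lat T_eta].
have T_gt0 x : 0 < T x by case: T_skew => /(_ x)/andP[].
have T_le x := entry_leq_row x T_skew T_lat.
split.
- by [].
- move=> i j i0 ij; rewrite /entry_array gtn_eqF //.
  apply/eqP; rewrite cards_eq0; apply/eqP/setP => b; rewrite !inE.
  apply: contraNF ij => /andP[/eqP <- /eqP <-].
  by rewrite T_le brow_stable.
- move=> j j0; rewrite row_end_entries // -card_row //; congr (_ + _).
  by apply: eq_card => b; rewrite !inE; case: eqP => //= <-; rewrite T_le.
(* Let c be the last column of row j+1 with an entry at most i+1.  The box
   above it, unless it belongs to mu, has an entry at most i. *)
- move=> i j j0; rewrite [leqLHS]row_end_entries //.
  set A := finset _; have [->|[y yA]] := set_0Vmem A.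
    rewrite cards0 addn0 row_end_entries //.
    by rewrite (leq_trans (part_geq mu_part (leqnSn j))) // leq_addr.
  set c := _ + _.
  have A0 : 0 < #|A| by apply/card_gt0P; exists y.
  have c_lam : c <= part lam j.+1.
    rewrite -card_row // leq_add2l; apply/subset_leq_card/fintype.subsetP => b.
    by rewrite !inE => /andP[].
  have [|b br bc] := @box_exists lam mu lam_part mu_part j.+1 c.
    by rewrite /in_skew c_lam andbT /= -[ltnLHS]addn0 ltn_add2l.
  have Tb : T b <= i.+1 by rewrite (tableau_row_end b i.+1 T_skew) br bc row_end_entries.
  have [muc|muc] := leqP c (part mu j).
    by rewrite (leq_trans muc) // row_end_entries // leq_addr.
  have [|d dr dc] := @box_exists lam mu lam_part mu_part j c.
    by rewrite /in_skew j0 muc (leq_trans c_lam) // part_geq.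
  rewrite -dr -dc -(tableau_row_end d i T_skew) -ltnS (leq_trans _ Tb) //.
  by apply: (tableau_ltn lam_part mu_part T_skew); rewrite ?dr ?br ?dc ?bc.
- move=> i j i0; rewrite /entry_array /= gtn_eqF // -!card_upper.
  exact: (lattice_upper lam_part mu_part T_skew).
- move=> j j_odd; have j0 : 0 < j by case: (j) j_odd.
  rewrite /entry_array gtn_eqF //= -!card_upper -!card_weight !T_eta //.
  by move/(even_partP eta_part): eta_even; apply.
Qed.

Lemma entry_array_inj T T' : even_LR n lam mu T -> even_LR n lam mu T' ->
  (forall i j, 1 <= i <= j -> j <= n -> row_count T i j = row_count T' i j) -> T = T'.
Proof.
move=> T_LR T'_LR eq_count.
have eq_end j i : row_end (entry_array T) j i = row_end (entry_array T') j i.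
  apply: eq_bigr => p _; have [->//|p0] := posnP p.
  have [/andP[pj jn]|pjn] := boolP (p <= j <= n).
    by rewrite /entry_array gtn_eqF // eq_count // p0.
  rewrite (array_support (even_LR_array T_LR)) //.
  by rewrite (array_support (even_LR_array T'_LR)).
case: T_LR T'_LR => eta _ [T_skew _ _] [eta' _ [T'_skew _ _]].
apply/ffunP => b; apply/eqP; rewrite eqn_leq.
rewrite (tableau_row_end _ _ T_skew) eq_end -(tableau_row_end _ _ T'_skew) leqnn /=.
by rewrite (tableau_row_end _ _ T'_skew) -eq_end -(tableau_row_end _ _ T_skew).
Qed.

(** * From arrays to tableaux *)

Section ToTableau.
Variable a : nat -> nat -> nat.
Hypothesis a_array : lr_array n lam mu a.

(** The least i with c <= row_end j i; it exists since row_end j n is lam_j. *)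
Definition array_filling : filling lam mu :=
  [ffun b => find (fun i => bcol b <= row_end a (brow b) i) (iota 0 n.+1)].

Lemma row_end0 j : 0 < j -> row_end a j 0 = part mu j.
Proof. by move=> j0; rewrite /row_end big_nat1 (array_mu a_array). Qed.

Lemma row_end_lam j i : 0 < j -> j <= i -> row_end a j i = part lam j.
Proof.
move=> j0 ji; rewrite -(array_lam a_array j0); apply: psum_const => // p jp.
by rewrite (array_support a_array) ?(leq_ltn_trans _ jp) // negb_and -ltnNge jp.
Qed.

Lemma row_end_bounds j i : 0 < j -> part mu j <= row_end a j i <= part lam j.
Proof.
move=> j0; rewrite -(row_end_lam j0 (leq_maxr i j)) -(row_end0 j0).
by rewrite !row_end_mono ?leq_maxl.
Qed.

Lemma row_end_strict j d i : 0 < j -> row_end a (j + d.+1) i.+1 <= row_end a j i.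
Proof.
move=> j0; elim: d => [|d IHd]; first by rewrite addn1 (array_strict a_array).
rewrite addnS (leq_trans (array_strict a_array _ _)) ?ltn_addr //.
by rewrite (leq_trans _ IHd) // row_end_mono.
Qed.

Lemma array_filling_leq b i :
  (array_filling b <= i) = (bcol b <= row_end a (brow b) i).
Proof.
rewrite ffunE find_iota_leq // => [j k jk /leq_trans|].
  by apply; exact: row_end_mono.
rewrite row_end_lam ?brow_stable ?brow_gt0 //.
by case/and3P: (box_skew b).
Qed.

Lemma array_filling_skew : skew_tableau n array_filling.
Proof.
split=> [b|b b' bc br|b b' br bc].
- have /and3P[r0 mub blam] := box_skew b.
  rewrite ltnNge array_filling_leq row_end0 // -ltnNge mub /=.
  apply: (@leq_trans n); last by rewrite -addnn leq_addr.
  by rewrite array_filling_leq row_end_lam ?brow_stable.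
- have := leqnn (array_filling b'); rewrite array_filling_leq.
  case: (array_filling b') => [|k].
    by case/and3P: (box_skew b') => r0 mub _; rewrite row_end0 // leqNgt mub.
  rewrite ltnS array_filling_leq -bc => /leq_trans; apply.
  by rewrite -(subnKC br) addSnnS row_end_strict ?brow_gt0.
- rewrite array_filling_leq; apply: leq_trans (ltnW bc) _.
  by rewrite br -array_filling_leq.
Qed.

(** The boxes of row j with entries at most i are those up to column
    row_end j i; the entries equal to i are counted by the difference. *)
Lemma row_count_array i j : 0 < i -> row_count array_filling i j = a i j.
Proof.
case: i => // i _; have [->|j0] := posnP j.
  rewrite (array_support a_array) //; apply/eqP; rewrite cards_eq0; apply/eqP/setP => b.
  by rewrite !inE eqn0Ngt brow_gt0.
have T_gt0 x : 0 < array_filling x by case: array_filling_skew => /(_ x)/andP[].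
have eq_end k : row_end (entry_array array_filling) j k = row_end a j k.
  have /andP[mu_end end_lam] := row_end_bounds k j0.
  rewrite row_end_entries // -[RHS](subnKC mu_end); congr (_ + _).
  rewrite -(card_row_initial lam_part mu_part j0) ?mu_end //.
  by apply: eq_card => b; rewrite !inE; case: eqP => //= <-; rewrite array_filling_leq.
by have := eq_end i.+1; rewrite !row_endS eq_end => /addnI.
Qed.

Lemma card_upper_array i j : 0 < i ->
  #|upper array_filling i j| = \sum_(0 <= q < j.+1) a i q.
Proof.
by move=> i0; rewrite card_upper; apply: eq_bigr => q _; exact: row_count_array.
Qed.

Lemma array_filling_even_LR : 0 < n -> even_LR n lam mu array_filling.
Proof.
move=> n0; pose weight i := #|upper array_filling i n|.
(* Partitions have no zero parts, so they are removed from the weight. *)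
pose eta := [seq x <- mkseq (fun i => weight i.+1) n | 0 < x].
have T_lat : lattice_word (word array_filling).
  apply: (upper_lattice lam_part mu_part array_filling_skew) => i j i0.
  by rewrite !card_upper_array // (array_lattice a_array).
have weightS i : weight i.+2 <= weight i.+1.
  rewrite /weight !card_upper_array // (leq_trans _ (array_lattice a_array n _)) //.
  by rewrite [leqRHS]big_nat_recr //= leq_addr.
have weight_homo := homo_leq (r := fun p q => q <= p) leqnn geq_trans weightS.
have weight_sorted : sorted geq (mkseq (fun i => weight i.+1) n).
  by rewrite sorted_map; apply: sub_sorted (iota_ltn_sorted 0 n) => i j /ltnW /weight_homo.
have etaE i : 0 < i -> weight i = part eta i.
  case: i => // i _; rewrite /part /= nth_filter_pos //.
  have [i_n|n_i] := ltnP i n; first by rewrite nth_mkseq.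
  rewrite nth_default ?size_mkseq // /weight card_upper_array // big1 // => q _.
  by rewrite (array_support a_array) // negb_and -!ltnNge; lia.
have eta_part : is_partition eta.
  by rewrite /is_partition (sorted_filter geq_trans) // mem_filter.
exists eta; last first.
  split=> // [|i i0]; first exact: array_filling_skew.
  by rewrite card_weight -etaE.
split.
  rewrite /typeA eta_part /= size_filter (leq_trans (count_size _ _)) //.
  by rewrite size_mkseq -addnn; lia.
apply/(even_partP eta_part) => j j_odd; have j0 : 0 < j by case: (j) j_odd.
by rewrite -!etaE // /weight !card_upper_array // (array_even a_array).
Qed.

End ToTableau.
End Arrays.

(** * Natural arrays as points of the polytope *)

Local Open Scope classical_set_scope.
Local Open Scope ring_scope.

(* The unqualified name denotes coordinates with respect to a basis. *)
Local Notation coord := Defs.coord.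

Section Coordinates.
Variables (R : realType) (n : nat) (mu : seq nat).
Hypothesis mu_stable : stable n mu.
Implicit Type x : vec R n.

Lemma coord_tri x (p : tri n) : coord mu x (val p).1 (val p).2 = x p.
Proof.
have /andP[p1 _] := valP p; rewrite /coord gtn_eqF //.
by rewrite (big_pred1 p) // => q; rewrite -!val_eqE.
Qed.

Lemma coord_mu x j : (0 < j)%N -> coord mu x 0 j = (part mu j)%:R.
Proof.
move=> j0; rewrite /coord /= j0; case: leqP => //= nj.
by rewrite part_default // (leq_ltn_trans _ nj) //; case/andP: mu_stable.
Qed.

Lemma coord_support x i j : (0 < i)%N -> ~~ (i <= j <= n)%N -> coord mu x i j = 0.
Proof.
move=> i0 ijn; rewrite /coord gtn_eqF // big_pred0 // => p.
apply: contraNF ijn => /andP[/eqP <- /eqP <-].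
by have /andP[_ ->] := valP p; rewrite -ltnS ltn_ord.
Qed.

Lemma tri_exists i j : (0 < i)%N -> (i <= j <= n)%N ->
  exists2 p : tri n, (val p).1 = i :> nat & (val p).2 = j :> nat.
Proof.
move=> i0 /andP[ij jn]; have i_n : (i < n.+1)%N by rewrite ltnS (leq_trans ij).
have pP : (1 <= (Ordinal i_n, Ordinal (jn : j < n.+1)%N).1
             <= (Ordinal i_n, Ordinal (jn : j < n.+1)%N).2)%N by rewrite i0.
by exists (exist _ (Ordinal i_n, Ordinal (jn : j < n.+1)%N) pP).
Qed.

End Coordinates.

Section PolytopeArray.
Variables (R : realType) (n : nat) (lam mu : seq nat).
Hypotheses (lam_stable : stable n lam) (mu_stable : stable n mu).
Variables (x : vec R n) (a : nat -> nat -> nat).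
(* At (0,0) the two sides may differ: coord vanishes there, whereas the parts
   of mu are numbered from 1. *)
Hypothesis coord_a : forall i j, (0 < i)%N || (0 < j)%N -> coord mu x i j = (a i j)%:R.

Lemma sum_coord_col j i : (0 < j)%N ->
  \sum_(0 <= p < i) coord mu x p j = (\sum_(0 <= p < i) a p j)%N%:R.
Proof.
by move=> j0; rewrite natr_sum; apply: eq_bigr => p _; rewrite coord_a ?j0 ?orbT.
Qed.

Lemma nat_mu j : (0 < j)%N -> a 0%N j = part mu j.
Proof.
by move=> j0; apply/eqP; rewrite -(eqr_nat R) -coord_a ?j0 // coord_mu.
Qed.

Lemma nat_support i j : (0 < i)%N -> ~~ (i <= j <= n)%N -> a i j = 0%N.
Proof.
by move=> i0 ij; apply/eqP; rewrite -(eqr_nat R) -coord_a ?i0 // coord_support.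
Qed.

Lemma sum_coord_row i m j : (0 < i)%N -> (m <= i)%N -> (m <= j)%N ->
  \sum_(m <= q < j) coord mu x i q = (\sum_(0 <= q < j) a i q)%N%:R.
Proof.
move=> i0 mi mj; have a0 : (\sum_(0 <= q < m) a i q = 0)%N.
  rewrite big_nat big1 // => q /andP[_ qm].
  by rewrite nat_support // negb_and -ltnNge (leq_trans qm).
rewrite [in RHS](big_cat_nat _ mj) //= a0 add0n natr_sum.
by apply: eq_bigr => q _; rewrite coord_a ?i0.
Qed.

Lemma sum_coord_lam j : (0 < j)%N ->
  \sum_(1 <= i < j.+1) coord mu x i j = (row_end a j j)%:R - (part mu j)%:R.
Proof.
move=> j0; rewrite /row_end -sum_coord_col // [in RHS]big_ltn // coord_mu //.
by rewrite addrAC subrr add0r.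
Qed.

(** The sums over truncated ranges in the polytope are the full sums, since the
    omitted entries vanish; each real condition is thus the cast of a natural
    one.  The conditions with j > n or i > j, which the polytope does not state,
    compare empty sums, or lam_j with lam_(j+1), or reduce to j = n. *)
Lemma polytope_array : LR_polytope R n lam mu x <-> lr_array n lam mu a.
Proof.
have lam_part : is_partition lam by case/andP: lam_stable.
split=> [[x_ge0 x_lam x_strict x_lat x_even]|].
  have a_lam j : (0 < j)%N -> row_end a j j = part lam j.
    move=> j0; have [jn|nj] := leqP j n.
      apply/eqP; rewrite -(eqr_nat R); apply/eqP.
      have := x_lam j; rewrite j0 jn sum_coord_lam // => /(_ isT); exact: addIr.
    rewrite part_default ?(leq_ltn_trans _ nj) //; last by case/andP: lam_stable.
    rewrite /row_end big1 // => -[|p] _; last by rewrite nat_support // [(j <= n)%N]leqNgt nj andbF.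
    by rewrite nat_mu // part_default // (leq_ltn_trans _ nj) //; case/andP: mu_stable.
  split=> //.
  - exact: nat_mu.
  - exact: nat_support.
  - move=> i j j0; have [ij|ji] := ltnP i j; last first.
      have a0 k p : (k < p)%N -> a p k = 0%N.
        by move=> kp; rewrite nat_support ?(leq_ltn_trans _ kp) // negb_and -ltnNge kp.
      rewrite /row_end (psum_const _ (a0 j.+1)) // (psum_const _ (a0 j)) //.
      by rewrite -!/(row_end _ _ _) !a_lam // part_geq.
    have [jn|nj] := leqP j n.
      by have := x_strict i.+1 j isT ij jn; rewrite !sum_coord_col // ler_nat.
    rewrite /row_end big1 // => -[|p] _.
      rewrite nat_mu // part_default // (@leq_ltn_trans n) //; last exact: leqW.
      by case/andP: mu_stable.
    by rewrite nat_support // [(j.+1 <= n)%N]leqNgt (leqW nj) andbF.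
  - move=> i j i0; have [ij|ji] := leqP i j; last first.
      rewrite big_nat big1 // => q /andP[_ qj]; rewrite nat_support //.
      by rewrite negb_and -ltnNge (leq_trans qj).
    have lat k : (i <= k)%N -> (k <= n)%N ->
        (\sum_(0 <= q < k.+2) a i.+1 q <= \sum_(0 <= q < k.+1) a i q)%N.
      move=> ik kn; have := x_lat i k i0 ik kn.
      by rewrite !sum_coord_row ?ler_nat // ltnW.
    have [|nj] := leqP j n; first exact: lat.
    have [i_n|ni] := leqP i n; last first.
      rewrite big1 // => q _; rewrite nat_support // negb_and -!ltnNge; lia.
    rewrite (@psum_const _ n.+2) ?ltnS ?(ltnW nj) // => [|q nq]; last first.
      by rewrite nat_support // negb_and -!ltnNge (ltnW nq) orbT.
    by rewrite (leq_trans (lat n i_n (leqnn n))) // leq_psum // ltnS ltnW.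
  - move=> j j_odd; have j0 : (0 < j)%N by case: (j) j_odd.
    have [jn|nj] := leqP j n.
      apply/eqP; rewrite -(eqr_nat R); apply/eqP.
      rewrite -!(@sum_coord_row _ 1) //.
      by apply: x_even; rewrite ?j0.
    by rewrite !big_nat !big1 // => q /andP[_ qn]; rewrite nat_support //; lia.
case=> a_mu a_supp a_lam a_strict a_lat a_even; split=> /=.
- by move=> p; rewrite -(coord_tri mu) coord_a ?ler0n //; case/andP: (valP p) => ->.
- by move=> j /andP[j0 jn]; rewrite sum_coord_lam // a_lam.
- move=> [//|i] j _ ij jn; have j0 : (0 < j)%N by exact: leq_ltn_trans ij.
  by rewrite !sum_coord_col // ler_nat a_strict.
- move=> i j i0 ij jn; have ij1 : (i <= j.+1)%N := leqW ij.
  by rewrite !sum_coord_row ?ler_nat // a_lat.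
- by move=> j /andP[j0 jn] j_odd; rewrite !sum_coord_row // a_even.
Qed.

End PolytopeArray.

(** * The polytope is a bounded polyhedron *)

Section Polyhedra.
Variables (R : realType) (n : nat).
Implicit Types (P Q : set (vec R n)) (f g : vec R n -> R).

Definition polyhedron P := exists hs : seq (vec R n * R),
  P = [set x : vec R n |
    forall h, h \in hs -> \sum_(p : tri n) h.1 p * x p <= h.2].

Definition affine f := exists (h : vec R n) (c : R),
  f = fun x => \sum_(p : tri n) h p * x p + c.

Lemma affine_cst c : affine (fun=> c).
Proof.
exists [ffun=> 0], c; apply/funext => x.
by rewrite big1 ?add0r // => p _; rewrite ffunE mul0r.
Qed.

Lemma affine_proj p : affine (fun x => x p).
Proof.
exists [ffun q => (q == p)%:R], 0; apply/funext => x.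
rewrite addr0 (bigD1 p) //= ffunE eqxx mul1r big1 ?addr0 // => q /negPf qp.
by rewrite ffunE qp mul0r.
Qed.

Lemma affineD f g : affine f -> affine g -> affine (fun x => f x + g x).
Proof.
move=> [hf [cf ->]] [hg [cg ->]].
exists [ffun p => hf p + hg p], (cf + cg); apply/funext => x.
rewrite addrACA -big_split /=; congr (_ + _); apply: eq_bigr => p _.
by rewrite ffunE mulrDl.
Qed.

Lemma affine_sum (I : Type) (r : seq I) (D : pred I) (F : I -> vec R n -> R) :
  (forall i, affine (F i)) -> affine (fun x => \sum_(i <- r | D i) F i x).
Proof.
move=> F_affine; elim: r => [|i r IHr].
  rewrite (_ : (fun x => _) = (fun=> 0)); first exact: affine_cst.
  by apply/funext => x; rewrite big_nil.
rewrite (_ : (fun x => _) = (fun x => (if D i then F i x else 0) +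
    \sum_(i <- r | D i) F i x)).
  by apply: affineD => //; case: (D i); [exact: F_affine|exact: affine_cst].
by apply/funext => x; rewrite big_cons; case: (D i); rewrite ?add0r.
Qed.

Lemma affine_coord mu i j : affine (fun x => coord mu x i j).
Proof.
rewrite /coord; case: (i == 0)%N; last by apply: affine_sum => p; exact: affine_proj.
by case: (1 <= j <= n)%N; exact: affine_cst.
Qed.

Lemma polyhedron_leq f g : affine f -> affine g -> polyhedron [set x | f x <= g x].
Proof.
move=> [hf [cf ->]] [hg [cg ->]].
exists [:: ([ffun p => hf p - hg p], cg - cf)]; apply/funext => x /=; apply/propext.
have -> : (\sum_p hf p * x p + cf <= \sum_p hg p * x p + cg) =
    (\sum_p [ffun p => hf p - hg p] p * x p <= cg - cf).
  under [in RHS]eq_bigr do rewrite ffunE mulrBl.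
  by rewrite sumrB lerBrDr addrAC lerBlDr [cg + _]addrC.
by split=> [le_x h|]; [rewrite inE => /eqP ->|move/(_ _ (mem_head _ _))].
Qed.

Lemma polyhedronI P Q : polyhedron P -> polyhedron Q -> polyhedron (P `&` Q).
Proof.
move=> [hP ->] [hQ ->]; exists (hP ++ hQ); apply/seteqP; split=> x /=.
  by move=> [xP xQ] h; rewrite mem_cat => /orP[/xP|/xQ].
by move=> xPQ; split=> h h_in; apply: xPQ; rewrite mem_cat h_in ?orbT.
Qed.

Lemma polyhedron_eq f g : affine f -> affine g -> polyhedron [set x | f x = g x].
Proof.
move=> f_aff g_aff.
rewrite (_ : [set _ | _] = [set x | f x <= g x] `&` [set x | g x <= f x]).
  by apply: polyhedronI; exact: polyhedron_leq.
apply/seteqP; split=> x /=; first by move->.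
by move=> [fg gf]; apply/le_anti; rewrite fg gf.
Qed.

(** The conditions of the polytope are indexed by bounded natural numbers, hence
    by a predicate on an infinite type with a list that exhausts it. *)
Lemma polyhedron_forall (I : eqType) (D : I -> Prop) (r : seq I)
    (P : I -> set (vec R n)) : (forall i, D i -> i \in r) ->
  (forall i, D i -> polyhedron (P i)) ->
  polyhedron [set x | forall i, D i -> P i x].
Proof.
move=> D_r P_poly.
suff H (s : seq I) : polyhedron [set x | forall i, i \in s -> D i -> P i x].
  have [hs eq_hs] := H r; exists hs; rewrite -eq_hs; apply/seteqP.
  by split=> x /= xP i => [_|Di]; [exact: xP|apply: xP => //; exact: D_r].
elim: s => [|i s IHs].
  by exists [::]; apply/seteqP; split.
have [Di|Di] := pselect (D i).
  rewrite (_ : [set _ | _] = P i `&` [set x | forall i, i \in s -> D i -> P i x]).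
    by apply: polyhedronI => //; exact: P_poly.
  apply/seteqP; split=> x /=.
    move=> xP; split=> [|k ks]; first by apply: xP; rewrite // inE eqxx.
    by apply: xP; rewrite inE ks orbT.
  by move=> [xPi xP] k; rewrite inE => /predU1P[->//|/xP].
rewrite (_ : [set _ | _] = [set x | forall i, i \in s -> D i -> P i x]) //.
apply/seteqP; split=> x /= xP k => [ks|]; first by apply: xP; rewrite inE ks orbT.
by rewrite inE => /predU1P[-> //|]; exact: xP.
Qed.

Lemma polyhedron_triangle (P : nat -> nat -> set (vec R n)) :
  (forall i j, polyhedron (P i j)) ->
  polyhedron [set x | forall i j,
    (1 <= i)%N -> (i <= j)%N -> (j <= n)%N -> P i j x].
Proof.
move=> P_poly; pose D (ij : nat * nat) :=
  [/\ (1 <= ij.1)%N, (ij.1 <= ij.2)%N & (ij.2 <= n)%N].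
rewrite (_ : [set _ | _] = [set x | forall ij, D ij -> P ij.1 ij.2 x]).
  apply: (@polyhedron_forall _ D [seq (i, j) | i <- iota 0 n.+1, j <- iota 0 n.+1]).
    move=> [i j] [_ ij jn]; apply: (allpairs_f pair); rewrite mem_iota //.
    by rewrite ltnS (leq_trans ij).
  by move=> ij _; exact: P_poly.
apply/seteqP; split=> x /= xP; first by move=> [i j] [/= ? ? ?]; exact: xP.
by move=> i j i1 ij jn; exact: (xP (i, j)).
Qed.

Lemma LR_polytope_polyhedron lam mu : polyhedron (LR_polytope R n lam mu).
Proof.
have aff_sum m k (F : nat -> nat * nat) :
    affine (fun x => \sum_(m <= p < k) coord mu x (F p).1 (F p).2).
  by apply: affine_sum => p; exact: affine_coord.
rewrite (_ : LR_polytope R n lam mu =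
  [set x : vec R n | forall p, True -> 0 <= x p] `&`
  [set x | forall j, (1 <= j <= n)%N ->
    \sum_(1 <= i < j.+1) coord mu x i j = (part lam j)%:R - (part mu j)%:R] `&`
  [set x | forall i j, (1 <= i)%N -> (i <= j)%N -> (j <= n)%N ->
    \sum_(0 <= p < i.+1) coord mu x p j.+1 <= \sum_(0 <= p < i) coord mu x p j] `&`
  [set x | forall i j, (1 <= i)%N -> (i <= j)%N -> (j <= n)%N ->
    \sum_(i.+1 <= q < j.+2) coord mu x i.+1 q <= \sum_(i <= q < j.+1) coord mu x i q] `&`
  [set x | forall j, (1 <= j <= n)%N /\ odd j ->
    \sum_(1 <= q < n.+1) coord mu x j q = \sum_(1 <= q < n.+1) coord mu x j.+1 q]).
  have in_iota j : (1 <= j <= n)%N -> j \in iota 0 n.+1.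
    by case/andP => _; rewrite mem_iota ltnS.
  repeat apply: polyhedronI.
  - apply: (@polyhedron_forall _ _ (enum (tri n))) => [p _|p _]; first by rewrite mem_enum.
    by apply: polyhedron_leq; [exact: affine_cst|exact: affine_proj].
  - apply: (@polyhedron_forall _ _ (iota 0 n.+1)) => // j _.
    by apply: polyhedron_eq; [exact: (aff_sum _ _ (fun p => (p, j)))|exact: affine_cst].
  - apply: polyhedron_triangle => i j.
    by apply: polyhedron_leq; [exact: (aff_sum _ _ (fun p => (p, j.+1)))
                              |exact: (aff_sum _ _ (fun p => (p, j)))].
  - apply: polyhedron_triangle => i j.
    by apply: polyhedron_leq; [exact: (aff_sum _ _ (pair i.+1))|exact: (aff_sum _ _ (pair i))].
  - apply: (@polyhedron_forall _ _ (iota 0 n.+1)) => [j [/in_iota]|j _] //.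
    by apply: polyhedron_eq; [exact: (aff_sum _ _ (pair j))|exact: (aff_sum _ _ (pair j.+1))].
apply/seteqP; split=> x /=.
  by move=> [x0 xlam xs xl xe]; split; [split; [split; [split|]|]|] => // j [? ?]; exact: xe.
by move=> [[[[x0 xlam] xs] xl] xe]; split => // [p|j ? ?]; [exact: x0|exact: xe].
Qed.

(** x p is one of the nonnegative terms of a row sum lam_j - mu_j. *)
Lemma LR_polytope_bounded lam mu x p : is_partition lam ->
  LR_polytope R n lam mu x -> `|x p| <= (part lam 1)%:R.
Proof.
move=> lam_part [x_ge0 x_lam _ _ _]; rewrite ger0_norm //.
have /andP[p1 p12] := valP p.
have pn : ((val p).2 <= n)%N by rewrite -ltnS ltn_ord.
have := x_lam (val p).2; rewrite (leq_trans p1) // pn => /(_ isT) p_lam.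
apply: (@le_trans _ _ ((part lam (val p).2)%:R)); last by rewrite ler_nat part_geq // (leq_trans p1).
apply: (@le_trans _ _ ((part lam (val p).2)%:R - (part mu (val p).2)%:R)).
  rewrite -p_lam -(coord_tri mu).
  rewrite (bigD1_seq ((val p).1 : nat)) ?mem_index_iota ?iota_uniq ?ltnS ?p1 //=.
  rewrite lerDl big_seq_cond sumr_ge0 // => i /andP[]; rewrite mem_index_iota => /andP[i1 _] _.
  by rewrite /coord gtn_eqF // sumr_ge0.
by rewrite lerBlDr lerDl ler0n.
Qed.

End Polyhedra.

Theorem theorem48 (R : realType) (n : nat) (lam mu : seq nat)
    (hn : (1 <= n)%N) (hlam : stable n lam) (hmu : stable n mu)
    (hsub : subpart mu lam) :
  [/\ even_LR n lam mu = LR_Sundaram n lam mu,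
      convex_polytope (LR_polytope R n lam mu)
    & set_bij (even_LR n lam mu)
        (LR_polytope R n lam mu `&` lattice_points R n)
        (v R n)].
Proof.
have /andP[lam_part lam_rows] := hlam; have /andP[mu_part _] := hmu.
have coord_v (T : filling lam mu) i j : lr_array n lam mu (entry_array T) ->
    (0 < i)%N || (0 < j)%N -> coord mu (v R n T) i j = (entry_array T i j)%:R.
  move=> T_array; have [->|i0 _] := posnP i; first exact: coord_mu.
  have [ijn|ijn] := boolP (i <= j <= n)%N; last first.
    by rewrite coord_support // (array_support T_array).
  have [p <- <-] := tri_exists i0 ijn.
  by rewrite coord_tri ffunE /entry_array gtn_eqF //; case/andP: (valP p).
split.
- apply/seteqP; split=> T; last by case=> eta [? ? ? _ _]; exists eta.
  case=> eta [eta_A eta_even] T_LR; exists eta; split=> // i _ b _.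
  by rewrite (leq_trans (brow_stable lam_rows b)) // leq_addr.
- split; first exact: LR_polytope_polyhedron.
  by exists (part lam 1)%:R => x xP p; exact: LR_polytope_bounded xP.
split.
- move=> T T_LR; have T_array := even_LR_array lam_part mu_part lam_rows hsub T_LR.
  split.
    by apply/(polytope_array hlam hmu (a := entry_array T)) => // i j /(coord_v T i j T_array).
  by move=> p; exists (row_count T (val p).1 (val p).2 : int); rewrite ffunE.
- move=> T T'; rewrite !inE => T_LR T'_LR vTT'.
  apply: (entry_array_inj lam_part mu_part lam_rows hsub T_LR T'_LR) => i j /andP[i0 ij] jn.
  have [|p <- <-] := @tri_exists n i j i0; first by rewrite ij.
  by move/ffunP/(_ p): vTT' => /eqP; rewrite !ffunE eqr_nat => /eqP.
- move=> x [xP x_int]; pose a i j := Num.truncn (coord mu x i j).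
  have coord_a i j : (0 < i)%N || (0 < j)%N -> coord mu x i j = (a i j)%:R.
    (* Nonnegativity turns the integral coordinates into natural numbers. *)
    move=> ij; apply/esym/truncnK; case: xP => x_ge0 _ _ _ _.
    have [i0|i0] := posnP i.
      by rewrite i0 /= in ij *; rewrite coord_mu // natr_nat.
    rewrite /coord gtn_eqF //; apply: rpred_sum => p _.
    have [[m|m] xm] := x_int p; first by rewrite xm natr_nat.
    by have := x_ge0 p; rewrite xm ler0z.
  have a_array : lr_array n lam mu a by apply/(polytope_array hlam hmu coord_a).
  have T_LR := array_filling_even_LR lam_part mu_part lam_rows a_array hn.
  exists (array_filling n lam mu a) => //; apply/ffunP => p.
  have /andP[p1 _] := valP p.
  rewrite ffunE -[#|_|]/(row_count _ (val p).1 (val p).2).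
  rewrite (row_count_array lam_part mu_part lam_rows a_array) //.
  by rewrite -coord_a ?p1 // coord_tri.
Qed.
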